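(* For the sequence of metrics $g_i=\varphi_i(r)^{-2}(dr^2+u_i^2(r)d\theta^2)+\varphi_i(r)^2d\xi^2$ on $\mathbb S^2\times\mathbb S^1$ ($r\in[0,2]$, $\theta,\xi\in[0,2\pi]$) constructed in the context, the limiting distance $d_*$ is strictly smaller than the intrinsic length distance $d_{g_\infty}$ of the local tensor limit $g_\infty$ at some points. More precisely, there exist two points $p,q\in\mathring M=\{0<r<2\}\times\mathbb S^1_\theta\times\mathbb S^1_\xi$ such that $$d_*(p,q)<d_{g_\infty}(p,q).$$
   Context: Construction. Let $A_i\to\infty$ (positive) and $\rho_i=\frac1{10}e^{-A_i^3}$. Let $\eta\in C^\infty(\mathbb R)$, $0\le\eta\le1$, $\eta(t)=0$ for $t\le0$, $\eta(t)=1$ for $t\ge1$. For $r>0$ set $$\psi_i(r)=\eta\Big(\frac{\ln(r/\rho_i)}{\ln2}\Big)\,\eta\Big(\frac{\ln(1/(10r))}{\ln2}\Big),\quad \lambda_i=\frac{A_i}{\int_0^{1/10}\frac{\psi_i(s)}s\,ds},\quad f_i(r)=-A_i+\lambda_i\int_0^r\frac{\psi_i(s)}s\,ds,\quad\varphi_i=e^{f_i}.$$ (So $f_i=-A_i$ on $[0,\rho_i]$ and $f_i=0$ for $r\ge\frac1{10}$.) For all large $i$, $u_i\in C^\infty([0,2])$ is the following concave function. On $[0,\frac15]$, $u_i$ solves $u_i''+|f_i'|^2u_i=0$, $u_i(0)=0$, $u_i'(0)=1$ (for large $i$ it is increasing and concave there with $u_i'\ge\frac12$). On $[\frac15,2]$,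 $u_i(r)=u_i(\frac15)+\int_{1/5}^rp_i(s)ds$, where $p_i$ is smooth and nonincreasing, equal to $u_i'(\frac15)$ near $\frac15$, equal to $-1$ on $[\frac95,2]$, with $\int_{1/5}^2p_i\,ds=-u_i(\frac15)$, the $p_i$ being chosen with $C^1$ bounds uniform in $i$. Thus $u_i(0)=u_i(2)=0$, $u_i'(0)=1$, $u_i'(2)=-1$, $u_i>0$ on $(0,2)$, $u_i(r)=r$ on $[0,\rho_i]$, $u_i(r)=2-r$ on $[\frac95,2]$, and $-u_i''/u_i\ge|f_i'|^2$ on $(0,2)$. The metrics $g_i$ are smooth with nonnegative scalar curvature, uniformly bounded volume, and a uniform positive lower bound for the areas of closed embedded minimal surfaces. Limits. After passing to a subsequence, $u_i\to u_\infty$ uniformly on $[0,2]$, $\varphi_i\to1$ locally uniformly on $(0,2)$; $g_\infty=dr^2+u_\infty^2d\theta^2+d\xi^2$ on $\mathring M$; $d_{g_\infty}$ is its length distance on $\mathring M$; and $d_*$ is the metric on $\mathring M$ such that the Riemannian distances $d_{g_i}$ of $(\mathbb S^2\times\mathbb S^1,g_i)$ converge to $d_*$ uniformly on $K\times K$ for every compact $K\subset\mathring M$. *)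

(* Defs.v *)
From Stdlib Require Import Reals List Lra.
From Coquelicot Require Import Coquelicot.
Open Scope R_scope.

(** * General notions *)

(** Elements of C^oo([a,b]) are represented below by smooth extensions to the
    whole line, so that derivatives at the end points are meaningful. *)
Definition smooth (f : R -> R) : Prop := forall n t, ex_derive_n f n t.

Definition compact_set {T : UniformSpace} (K : T -> Prop) : Prop :=
  forall (I : Type) (U : I -> T -> Prop),
    (forall i, open (U i)) ->
    (forall x, K x -> exists i, U i x) ->
    exists l : list I, forall x, K x -> exists i, In i l /\ U i x.

Definition unif_cv {T : Type} (D : T -> Prop) (F : nat -> T -> R) (f : T -> R) :
  Prop :=
  forall eps, 0 < eps ->
    exists N : nat, forall n, (N <= n)%nat ->
      forall x, D x -> Rabs (F n x - f x) < eps.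

Record is_metric_on {T : Type} (D : T -> Prop) (d : T -> T -> R) : Prop := {
  metric_ge0 : forall x y, D x -> D y -> 0 <= d x y;
  metric_eq0 : forall x y, D x -> D y -> (d x y = 0 <-> x = y);
  metric_sym : forall x y, D x -> D y -> d x y = d y x;
  metric_tri : forall x y z, D x -> D y -> D z -> d x z <= d x y + d y z }.

(** * The manifold S^2 x S^1 and warped metrics on it *)

(** S^2 x S^1 is the product of the unit sphere and the unit circle in
    R^3 x R^2; the coordinates (r, theta, xi), 0 <= r <= 2, enter through
    [polar].  The circles r = 0 and r = 2 lie over the poles of S^2. *)
Definition point : Type := ((R * R * R) * (R * R))%type.

Definition polar (r theta xi : R) : point :=
  ((sin (PI / 2 * r) * cos theta, sin (PI / 2 * r) * sin theta,
    cos (PI / 2 * r)),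
   (cos xi, sin xi)).

Definition S2xS1 (p : point) : Prop :=
  let '((x, y, z), (c, s)) := p in
  x ^ 2 + y ^ 2 + z ^ 2 = 1 /\ c ^ 2 + s ^ 2 = 1.

Definition rcoord (p : point) : R := 2 / PI * acos (snd (fst p)).

(** The open part 0 < r < 2. *)
Definition Mint (p : point) : Prop := S2xS1 p /\ 0 < rcoord p < 2.

(** The quadratic form phi^-2 (dr^2 + u^2 dtheta^2) + phi^2 dxi^2, evaluated
    at a tangent vector [v] at [p].  Off the poles
    dr = - (2/PI) dz / sqrt (x^2 + y^2), dtheta = (x dy - y dx) / (x^2 + y^2),
    dxi = c ds - s dc.  At the poles dr^2 + u^2 dtheta^2 has the continuous
    extension (2/PI)^2 (dx^2 + dy^2) when u vanishes at r = 0, 2 with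
    derivatives 1, -1.  See [warped_polar] below. *)
Definition warped (phi u : R -> R) (p v : point) : R :=
  let '((x, y, z), (c, s)) := p in
  let '((vx, vy, vz), (vc, vs)) := v in
  let r := rcoord p in
  let w := x ^ 2 + y ^ 2 in
  let base :=
    if Req_EM_T w 0 then (2 / PI) ^ 2 * (vx ^ 2 + vy ^ 2)
    else (2 / PI * vz) ^ 2 / w + u r ^ 2 * ((x * vy - y * vx) / w) ^ 2 in
  base / phi r ^ 2 + phi r ^ 2 * (c * vs - s * vc) ^ 2.

(** [joins X g p q L]: some piecewise C^1 curve in [X] from [p] to [q] has
    [g]-length [L].  The curve is given as a chain of C^1 pieces, and each piece
    as the restriction to [a, b] of a C^1 map on the line with velocity [v]. *)
Inductive joins (X : point -> Prop) (g : point -> point -> R) :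
  point -> point -> R -> Prop :=
| joins_nil : forall p, X p -> joins X g p p 0
| joins_cons : forall (gamma v : R -> point) (a b L L' : R) (q : point),
    a < b ->
    (forall t, is_derive gamma t (v t)) ->
    (forall t, continuous v t) ->
    (forall t, a <= t <= b -> X (gamma t)) ->
    is_RInt (fun t => sqrt (g (gamma t) (v t))) a b L ->
    joins X g (gamma b) q L' ->
    joins X g (gamma a) q (L + L').

(** The infimum is finite for [S2xS1] and [Mint]: they are connected, so curves of
    finite length join any two points. *)
Definition length_dist (X : point -> Prop) (g : point -> point -> R)
  (p q : point) : R :=
  real (Glb_Rbar (joins X g p q)).

(** * The construction *)

Definition cutoff (eta : R -> R) : Prop :=
  smooth eta /\ (forall t, 0 <= eta t <= 1) /\
  (forall t, t <= 0 -> eta t = 0) /\ (forall t, 1 <= t -> eta t = 1).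

Definition rho (A : R) : R := / 10 * exp (- A ^ 3).

(** Only the values for 0 < r matter. *)
Definition psi (eta : R -> R) (A r : R) : R :=
  eta (ln (r / rho A) / ln 2) * eta (ln (1 / (10 * r)) / ln 2).

Definition lambda (eta : R -> R) (A : R) : R :=
  A / RInt (fun s => psi eta A s / s) 0 (1 / 10).

Definition logphi (eta : R -> R) (A r : R) : R :=
  - A + lambda eta A * RInt (fun s => psi eta A s / s) 0 r.

Definition phi (eta : R -> R) (A r : R) : R := exp (logphi eta A r).

(** The function u_i together with the function p_i used on [1/5, 2]. *)
Record profile (eta : R -> R) (A : R) (u p : R -> R) : Prop := {
  u_smooth : smooth u;
  u_ode : forall r, 0 <= r <= 1 / 5 ->
    Derive_n u 2 r + Rabs (Derive (logphi eta A) r) ^ 2 * u r = 0;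
  u_0 : u 0 = 0;
  u'_0 : Derive u 0 = 1;
  u_outer : forall r, 1 / 5 <= r <= 2 -> u r = u (1 / 5) + RInt p (1 / 5) r;
  p_smooth : smooth p;
  p_nonincr : forall r s, 1 / 5 <= r -> r <= s -> s <= 2 -> p s <= p r;
  p_left : exists delta, 0 < delta /\
    forall r, 1 / 5 <= r < 1 / 5 + delta -> p r = Derive u (1 / 5);
  p_right : forall r, 9 / 5 <= r <= 2 -> p r = -1;
  p_total : RInt p (1 / 5) 2 = - u (1 / 5) }.

Definition metric_g (eta : R -> R) (A : R) (u : R -> R) : point -> point -> R :=
  warped (phi eta A) u.

(** dr^2 + u^2 dtheta^2 + dxi^2 *)
Definition metric_lim (u : R -> R) : point -> point -> R :=
  warped (fun _ => 1) u.

(** * [warped] in polar coordinates, poles included *)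

(** The differential of [polar] at (r, theta, xi), applied to (dr, dtheta, dxi). *)
Definition dpolar (r theta xi dr dtheta dxi : R) : point :=
  ((PI / 2 * dr * cos (PI / 2 * r) * cos theta
      - sin (PI / 2 * r) * (dtheta * sin theta),
    PI / 2 * dr * cos (PI / 2 * r) * sin theta
      + sin (PI / 2 * r) * (dtheta * cos theta),
    - (PI / 2 * dr * sin (PI / 2 * r))),
   (- (dxi * sin xi), dxi * cos xi)).

Lemma rcoord_polar (r theta xi : R) :
  0 <= r <= 2 -> rcoord (polar r theta xi) = r.
Proof.
  intros Hr. pose proof PI_RGT_0. unfold rcoord, polar; simpl.
  rewrite acos_cos; [field; lra | nra].
Qed.

Lemma warped_polar (phi u : R -> R) (r theta xi dr dtheta dxi : R) :
  u 0 = 0 -> u 2 = 0 -> 0 <= r <= 2 ->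
  warped phi u (polar r theta xi) (dpolar r theta xi dr dtheta dxi)
  = (dr ^ 2 + u r ^ 2 * dtheta ^ 2) / phi r ^ 2 + phi r ^ 2 * dxi ^ 2.
Proof.
  intros U0 U2 Hr. pose proof PI_RGT_0 as HPI.
  pose proof (rcoord_polar r theta xi Hr) as Er.
  unfold warped, polar, dpolar in *. rewrite Er. clear Er.
  set (S := sin (PI / 2 * r)). set (C := cos (PI / 2 * r)).
  set (st := sin theta). set (ct := cos theta).
  assert (T : st ^ 2 = 1 - ct ^ 2).
  { pose proof (sin2_cos2 theta) as E; unfold Rsqr in E; fold st ct in E; lra. }
  assert (X : cos xi * (dxi * cos xi) - sin xi * (- (dxi * sin xi)) = dxi).
  { pose proof (sin2_cos2 xi) as E; unfold Rsqr in E.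
    replace dxi with (dxi * 1) at 3 by ring. rewrite <- E; ring. }
  rewrite X.
  assert (W : (S * ct) ^ 2 + (S * st) ^ 2 = S ^ 2).
  { transitivity (S ^ 2 * (ct ^ 2 + st ^ 2)); [ring | rewrite T; ring]. }
  rewrite W. apply (f_equal (fun b => b / phi r ^ 2 + phi r ^ 2 * dxi ^ 2)).
  destruct (Req_EM_T (S ^ 2) 0) as [HS | HS].
  - assert (S0 : S = 0) by nra.
    assert (C2 : C ^ 2 = 1).
    { pose proof (sin2_cos2 (PI / 2 * r)) as E; unfold Rsqr in E.
      fold S C in E; nra. }
    assert (Ur : u r = 0).
    { destruct (Req_dec r 0) as [-> | H0]; [exact U0 |].
      destruct (Req_dec r 2) as [-> | H2]; [exact U2 |].
      assert (0 < S) by (apply sin_gt_0; nra). lra. }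
    rewrite S0, Ur.
    transitivity (dr ^ 2 * C ^ 2 * (ct ^ 2 + st ^ 2)); [field; lra |].
    rewrite C2, T; ring.
  - assert (S <> 0) by (intros E; apply HS; rewrite E; ring).
    assert (D : S * ct * (PI / 2 * dr * C * st + S * (dtheta * ct))
                - S * st * (PI / 2 * dr * C * ct - S * (dtheta * st))
                = S ^ 2 * dtheta).
    { transitivity (S ^ 2 * dtheta * (ct ^ 2 + st ^ 2)); [ring | rewrite T; ring]. }
    rewrite D. field; split; lra.
Qed.

(* Main.v *)
Require Import Defs.
From Stdlib Require Import Reals Lra Lia.
From Coquelicot Require Import Coquelicot.
Open Scope R_scope.

(** The points x and y both have r = 1/10 and theta = 0, and lie at xi = 0 and
    xi = PI.

    For g_infinity they are far apart: on the circle factor |d cos xi| <= |dxi|,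
    and g_infinity contains the term dxi^2 with coefficient 1, so the length of
    a curve is at least the variation of cos xi ([fibre_displacement_le]), and
    the distance is at least 2.

    For g_i there is a detour through the pole r = 0, which is removed from the
    domain of g_infinity.  There the fibre has length 2 PI e^(-A_i), so half of
    it costs a negligible PI e^(-A_i).  The point is that reaching the pole is
    cheap although phi_i^(-1) is as large as e^(A_i).  The integral of psi_i(s)/s
    over [0, 1/10] is about A_i^3, hence lambda_i <= 1/2 for large A_i
    ([lambda_bounds]), hence f_i(r) >= - lambda_i ln (1/(10 r)) gives
    phi_i(r) >= sqrt (10 r) ([phi_ge]).  So the radial segment from r = 1/10 to
    the pole is at most the integral of (10 r)^(-1/2) long, which is 1/5
    ([joins_radial]).  The detour has length at most 2/5 + PI e^(-A_i)
    ([shortcut]); its limit 2/5 bounds d_*(x, y) and is smaller than 2. *)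

(** * Curves in polar coordinates *)

Lemma is_derive_pair {U V : NormedModule R_AbsRing}
  (f : R -> U) (g : R -> V) (t : R) (df : U) (dg : V) :
  is_derive f t df -> is_derive g t dg ->
  is_derive (fun x => (f x, g x)) t (df, dg).
Proof.
  intros Hf Hg.
  apply (filterdiff_comp'_2 f g (fun a b => (a, b)) t
    (fun y => scal y df) (fun y => scal y dg) (fun a b => (a, b)) Hf Hg).
  apply (filterdiff_ext (fun z => z)); [now intros [a b] |].
  apply (filterdiff_ext_lin _ (fun z => z)); [apply filterdiff_id | now intros [a b]].
Qed.

Lemma continuous_pair {T U V : UniformSpace} (f : T -> U) (g : T -> V) (t : T) :
  continuous f t -> continuous g t -> continuous (fun x => (f x, g x)) t.
Proof.
  intros Hf Hg.
  apply (continuous_comp_2 f g (fun a b => (a, b)) t Hf Hg).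
  apply (continuous_ext (fun z => z)); [now intros [a b] | apply continuous_id].
Qed.

Lemma is_derive_continuous (f : R -> R) (t l : R) :
  is_derive f t l -> continuous f t.
Proof. intros H. apply (ex_derive_continuous f). now exists l. Qed.

Lemma is_derive_polar (r theta xi : R -> R) (t dr dtheta dxi : R) :
  is_derive r t dr -> is_derive theta t dtheta -> is_derive xi t dxi ->
  is_derive (fun s => polar (r s) (theta s) (xi s)) t
    (dpolar (r t) (theta t) (xi t) dr dtheta dxi).
Proof.
  intros Hr Hth Hxi.
  pose proof (is_derive_unique _ _ _ Hr) as Er.
  pose proof (is_derive_unique _ _ _ Hth) as Eth.
  pose proof (is_derive_unique _ _ _ Hxi) as Exi.
  assert (ex_derive r t) by now exists dr.
  assert (ex_derive theta t) by now exists dtheta.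
  assert (ex_derive xi t) by now exists dxi.
  unfold polar, dpolar.
  repeat apply @is_derive_pair; auto_derive; auto;
    change (Derive (fun x => r x) t) with (Derive r t);
    change (Derive (fun x => theta x) t) with (Derive theta t);
    change (Derive (fun x => xi x) t) with (Derive xi t);
    rewrite ?Er, ?Eth, ?Exi; ring.
Qed.

Lemma continuous_sin_comp (f : R -> R) (t : R) :
  continuous f t -> continuous (fun s => sin (f s)) t.
Proof. intros H. now apply (continuous_comp f sin), continuous_sin. Qed.

Lemma continuous_cos_comp (f : R -> R) (t : R) :
  continuous f t -> continuous (fun s => cos (f s)) t.
Proof. intros H. now apply (continuous_comp f cos), continuous_cos. Qed.

Lemma continuous_dpolar (r theta xi dr dtheta dxi : R -> R) (t : R) :
  continuous r t -> continuous theta t -> continuous xi t ->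
  continuous dr t -> continuous dtheta t -> continuous dxi t ->
  continuous
    (fun s => dpolar (r s) (theta s) (xi s) (dr s) (dtheta s) (dxi s)) t.
Proof.
  intros. unfold dpolar.
  repeat match goal with
  | |- continuous (fun x => (_, _)) _ => apply @continuous_pair
  | |- continuous (fun x => sin _) _ => apply continuous_sin_comp
  | |- continuous (fun x => cos _) _ => apply continuous_cos_comp
  | |- continuous (fun x => - _) _ =>
      apply (@continuous_opp R_UniformSpace R_AbsRing R_NormedModule)
  | |- continuous (fun x => _ + _) _ =>
      apply (@continuous_plus R_UniformSpace R_AbsRing R_NormedModule)
  | |- continuous (fun x => _ - _) _ =>
      apply (@continuous_minus R_UniformSpace R_AbsRing R_NormedModule)
  | |- continuous (fun x => _ * _) _ =>
      apply (@continuous_mult R_UniformSpace R_AbsRing)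
  | |- continuous (fun x => ?c) _ => apply continuous_const
  | |- _ => assumption
  end.
Qed.

Lemma S2xS1_polar (r theta xi : R) : S2xS1 (polar r theta xi).
Proof.
  assert (E : forall a, sin a ^ 2 = 1 - cos a ^ 2).
  { intros a. pose proof (sin2_cos2 a) as H; unfold Rsqr in H; lra. }
  unfold S2xS1, polar. rewrite !Rpow_mult_distr, !E. split; ring.
Qed.

Lemma Mint_polar (r theta xi : R) : 0 < r < 2 -> Mint (polar r theta xi).
Proof.
  intros Hr. split; [apply S2xS1_polar | rewrite rcoord_polar; lra].
Qed.

Lemma joins_polar (X : point -> Prop) (phi u r theta xi dr dtheta dxi : R -> R)
  (a b L L' : R) (q : point) :
  u 0 = 0 -> u 2 = 0 -> a < b ->
  (forall t, is_derive r t (dr t)) -> (forall t, continuous dr t) ->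
  (forall t, is_derive theta t (dtheta t)) -> (forall t, continuous dtheta t) ->
  (forall t, is_derive xi t (dxi t)) -> (forall t, continuous dxi t) ->
  (forall t, a <= t <= b -> 0 <= r t <= 2) ->
  (forall t, a <= t <= b -> X (polar (r t) (theta t) (xi t))) ->
  is_RInt (fun t => sqrt ((dr t ^ 2 + u (r t) ^ 2 * dtheta t ^ 2)
                            / phi (r t) ^ 2 + phi (r t) ^ 2 * dxi t ^ 2)) a b L ->
  joins X (warped phi u) (polar (r b) (theta b) (xi b)) q L' ->
  joins X (warped phi u) (polar (r a) (theta a) (xi a)) q (L + L').
Proof.
  intros U0 U2 Hab Hr Cr Hth Cth Hxi Cxi Hr02 HX HL Hq.
  apply (joins_cons X (warped phi u) (fun t => polar (r t) (theta t) (xi t))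
    (fun t => dpolar (r t) (theta t) (xi t) (dr t) (dtheta t) (dxi t)) a b);
    auto.
  - intros t. now apply is_derive_polar.
  - intros t. apply continuous_dpolar; auto; eapply is_derive_continuous; eauto.
  - apply is_RInt_ext with (2 := HL).
    intros t. rewrite Rmin_left, Rmax_right by lra. intros Ht.
    rewrite warped_polar; auto. apply Hr02; lra.
Qed.

(** * Bounds for length distances *)

Lemma joins_ge0 (X : point -> Prop) (g : point -> point -> R) (p q : point)
  (L : R) : joins X g p q L -> 0 <= L.
Proof.
  induction 1 as [| gamma v a b L L' q Hab _ _ _ HL _ IH]; [lra |].
  assert (0 <= L); [| lra].
  rewrite <- (is_RInt_unique _ _ _ _ HL).
  apply RInt_ge_0; [lra | now exists L | intros; apply sqrt_pos].
Qed.

(** Some curve is needed even for the lower bound: the infimum of the empty set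
    is infinite and [real] would turn it into 0. *)
Lemma length_dist_bounds (X : point -> Prop) (g : point -> point -> R)
  (p q : point) (m L : R) :
  (forall l, joins X g p q l -> m <= l) -> joins X g p q L ->
  m <= length_dist X g p q <= L.
Proof.
  intros Hm HL. unfold length_dist.
  destruct (Glb_Rbar_correct (joins X g p q)) as [lb glb].
  specialize (lb L HL). assert (H := glb m Hm). clear glb.
  destruct (Glb_Rbar (joins X g p q)); simpl in *; intuition.
Qed.

Lemma warped_ge_fibre (phi u : R -> R) (x y z c s vx vy vz vc vs : R) :
  phi (rcoord ((x, y, z), (c, s))) ^ 2 * (c * vs - s * vc) ^ 2
  <= warped phi u ((x, y, z), (c, s)) ((vx, vy, vz), (vc, vs)).
Proof.
  unfold warped. set (f := phi (rcoord _)). set (r := rcoord _).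
  assert (0 <= / f ^ 2).
  { rewrite <- pow_inv. apply pow2_ge_0. }
  assert (P : forall B, 0 <= B ->
    f ^ 2 * (c * vs - s * vc) ^ 2 <= B / f ^ 2 + f ^ 2 * (c * vs - s * vc) ^ 2).
  { intros B HB. unfold Rdiv. pose proof (Rmult_le_pos _ _ HB H). lra. }
  apply P. destruct (Req_EM_T (x ^ 2 + y ^ 2) 0) as [E | E].
  - apply Rmult_le_pos; [apply pow2_ge_0 |].
    pose proof (pow2_ge_0 vx); pose proof (pow2_ge_0 vy); lra.
  - assert (0 < x ^ 2 + y ^ 2).
    { pose proof (pow2_ge_0 x); pose proof (pow2_ge_0 y); lra. }
    apply Rplus_le_le_0_compat.
    + apply Rmult_le_pos; [apply pow2_ge_0 | left; now apply Rinv_0_lt_compat].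
    + apply Rmult_le_pos; apply pow2_ge_0.
Qed.

(** The first coordinate c of the circle factor is cos xi.  As (c, s) is a unit
    vector orthogonal to its velocity, |dc| is at most |c ds - s dc| = |dxi|,
    which the metric bounds by the speed.  The chord |c(p) - c(q)| is weaker than
    the arc length but needs no lift of the angle along the curve. *)
Lemma fibre_displacement_le (X : point -> Prop) (u : R -> R) (p q : point)
  (L : R) :
  (forall x, X x -> S2xS1 x) ->
  joins X (metric_lim u) p q L -> Rabs (fst (snd p) - fst (snd q)) <= L.
Proof.
  intros HX.
  induction 1 as [p _ | gamma v a b L L' q Hab Hg Hv Hin HL _ IH].
  { rewrite Rminus_diag, Rabs_R0. lra. }
  set (c := fun t => fst (snd (gamma t))). set (s := fun t => snd (snd (gamma t))).
  set (dc := fun t => fst (snd (v t))). set (ds := fun t => snd (snd (v t))).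
  assert (Hsnd : forall t, is_derive (fun t => snd (gamma t)) t (snd (v t))).
  { intros t. apply (filterdiff_comp' gamma snd t _ snd (Hg t)).
    apply filterdiff_linear, is_linear_snd. }
  assert (Hc : forall t, is_derive c t (dc t)).
  { intros t. apply (filterdiff_comp' (fun t => snd (gamma t)) fst t _ fst (Hsnd t)).
    apply filterdiff_linear, is_linear_fst. }
  assert (Hs : forall t, is_derive s t (ds t)).
  { intros t. apply (filterdiff_comp' (fun t => snd (gamma t)) snd t _ snd (Hsnd t)).
    apply filterdiff_linear, is_linear_snd. }
  assert (Cdc : forall t, continuous dc t).
  { intros t. apply (continuous_comp (fun t => snd (v t)) fst).
    - apply (continuous_comp v snd); [apply Hv |].
      destruct (v t); apply continuous_snd.
    - destruct (snd (v t)); apply continuous_fst. }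
  assert (Hcirc : forall t, a <= t <= b -> c t ^ 2 + s t ^ 2 = 1).
  { intros t Ht. specialize (HX _ (Hin t Ht)). unfold c, s. revert HX.
    destruct (gamma t) as [[[x y] z] [c0 s0]]. simpl. tauto. }
  assert (Hperp : forall t, a < t < b -> c t * dc t + s t * ds t = 0).
  { intros t Ht.
    assert (D : is_derive (fun t => c t ^ 2 + s t ^ 2) t
                  (2 * (c t * dc t + s t * ds t))).
    { assert (ex_derive c t) by (eexists; apply Hc).
      assert (ex_derive s t) by (eexists; apply Hs).
      auto_derive; auto.
      change (Derive (fun x => c x) t) with (Derive c t).
      change (Derive (fun x => s x) t) with (Derive s t).
      rewrite (is_derive_unique _ _ _ (Hc t)), (is_derive_unique _ _ _ (Hs t)).
      ring. }
    assert (D0 : is_derive (fun t => c t ^ 2 + s t ^ 2) t 0).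
    { apply is_derive_ext_loc with (fun _ => 1); [| apply @is_derive_const].
      apply (locally_interval _ t a b); simpl; try lra.
      intros y Hy1 Hy2. symmetry; apply Hcirc; lra. }
    apply is_derive_unique in D, D0. lra. }
  assert (Hspeed : forall t, a < t < b ->
    Rabs (dc t) <= sqrt (metric_lim u (gamma t) (v t))).
  { intros t Ht. rewrite <- sqrt_Rsqr_abs. apply sqrt_le_1_alt.
    apply Rle_trans with ((c t * ds t - s t * dc t) ^ 2).
    -
      (* Lagrange's identity: the right-hand side is dc ^ 2 + ds ^ 2. *)
      specialize (Hperp t Ht). assert (C := Hcirc t ltac:(lra)).
      assert (I : (c t * ds t - s t * dc t) ^ 2
                  = (c t ^ 2 + s t ^ 2) * (dc t ^ 2 + ds t ^ 2)
                    - (c t * dc t + s t * ds t) ^ 2) by ring.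
      rewrite I, C, Hperp. unfold Rsqr. pose proof (pow2_ge_0 (ds t)). lra.
    - unfold c, s, dc, ds, metric_lim.
      destruct (gamma t) as [[[x y] z] [c0 s0]].
      destruct (v t) as [[[vx vy] vz] [vc vs]].
      pose proof (warped_ge_fibre (fun _ => 1) u x y z c0 s0 vx vy vz vc vs) as W.
      simpl fst; simpl snd. lra. }
  assert (Hint : is_RInt dc a b (c b - c a)).
  { apply (is_RInt_derive c dc); intros; auto. }
  assert (c b - c a <= L).
  { apply (is_RInt_le dc _ a b _ _ (Rlt_le _ _ Hab) Hint HL).
    intros t Ht. specialize (Hspeed t Ht). pose proof (Rle_abs (dc t)). lra. }
  assert (- (c b - c a) <= L).
  { apply (is_RInt_le (fun t => - dc t) _ a b _ _ (Rlt_le _ _ Hab)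
             (is_RInt_opp _ _ _ _ Hint) HL).
    intros t Ht. specialize (Hspeed t Ht).
    pose proof (Rle_abs (- dc t)) as H0. rewrite Rabs_Ropp in H0. lra. }
  change (fst (snd (gamma a))) with (c a).
  change (fst (snd (gamma b))) with (c b) in IH.
  apply Rcomplements.Rabs_le_between in IH. apply Rabs_le. lra.
Qed.

(** * The warping function *)

Lemma rho_pos (A : R) : 0 < rho A.
Proof. unfold rho. pose proof (exp_pos (- A ^ 3)). lra. Qed.

Lemma ln2_pos : 0 < ln 2.
Proof. rewrite <- ln_1. apply ln_increasing; lra. Qed.

Lemma psi_bounds (eta : R -> R) (A r : R) :
  cutoff eta -> 0 <= psi eta A r <= 1.
Proof.
  intros (_ & H & _). unfold psi.
  pose proof (H (ln (r / rho A) / ln 2)). pose proof (H (ln (1 / (10 * r)) / ln 2)).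
  nra.
Qed.

Lemma psi_near_0 (eta : R -> R) (A r : R) :
  cutoff eta -> r < rho A -> psi eta A r = 0.
Proof.
  intros (_ & _ & H & _) Hr. unfold psi. rewrite (H (_ / ln 2)); [ring |].
  pose proof ln2_pos. pose proof (rho_pos A).
  assert (ln (r / rho A) <= 0).
  { destruct (Rle_lt_dec (r / rho A) 0) as [E | E].
    - (* [ln] takes the default value 0 here. *)
      unfold ln. destruct (Rlt_dec 0 (r / rho A)) as [C |];
        [exfalso; lra | right; reflexivity].
    - rewrite <- ln_1. apply ln_le; auto. apply Rle_div_l; lra. }
  apply Rle_div_l; lra.
Qed.

Lemma psi_middle (eta : R -> R) (A r : R) :
  cutoff eta -> 2 * rho A <= r <= 1 / 20 -> psi eta A r = 1.
Proof.
  intros (_ & _ & _ & H) Hr. unfold psi.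
  pose proof ln2_pos. pose proof (rho_pos A).
  rewrite !H; [ring | |].
  - apply Rle_div_r; auto. rewrite Rmult_1_l. apply ln_le; [lra |].
    apply Rle_div_r; lra.
  - apply Rle_div_r; auto. rewrite Rmult_1_l. apply ln_le; [lra |].
    apply Rle_div_r; lra.
Qed.

(** The singularity of 1/s is harmless because psi vanishes for s < [rho A];
    elsewhere the quotient is differentiable. *)
Lemma continuous_psi_div (eta : R -> R) (A s : R) :
  cutoff eta -> continuous (fun s => psi eta A s / s) s.
Proof.
  intros Heta. pose proof (rho_pos A). pose proof ln2_pos.
  destruct (Rlt_le_dec s (rho A)) as [Hs | Hs].
  - apply continuous_ext_loc with (fun _ => 0); [| apply continuous_const].
    apply (locally_interval _ s m_infty (rho A)); simpl; auto.
    intros y _ Hy. rewrite psi_near_0 by auto. unfold Rdiv. ring.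
  - assert (E : forall t, ex_derive eta t) by (intros t; apply (proj1 Heta 1%nat t)).
    apply (ex_derive_continuous (fun s => psi eta A s / s)).
    unfold psi. auto_derive. repeat split; auto; try lra.
    + apply Rdiv_lt_0_compat; lra.
    + apply Rdiv_lt_0_compat; lra.
Qed.

Lemma ex_RInt_psi_div (eta : R -> R) (A a b : R) :
  cutoff eta -> ex_RInt (fun s => psi eta A s / s) a b.
Proof.
  intros Heta. apply (ex_RInt_continuous (V := R_CompleteNormedModule)).
  intros z _. now apply continuous_psi_div.
Qed.

Lemma continuous_phi (eta : R -> R) (A r : R) :
  cutoff eta -> continuous (phi eta A) r.
Proof.
  intros Heta. unfold phi, logphi.
  apply (ex_derive_continuous (fun r => exp _)). auto_derive.
  repeat split; auto.
  - now apply ex_RInt_psi_div.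
  - apply filter_forall. intros y. apply continuity_pt_filterlim.
    now apply continuous_psi_div.
Qed.

Lemma is_RInt_inv (a b : R) :
  0 < a <= b -> is_RInt (fun s => 1 / s) a b (ln b - ln a).
Proof.
  intros Hab. apply (is_RInt_derive ln); rewrite Rmin_left, Rmax_right by lra;
    intros x Hx.
  - auto_derive; [lra | reflexivity].
  - apply (ex_derive_continuous (fun s => 1 / s)). auto_derive. lra.
Qed.

(** On [2 rho, 1/20] the integrand is 1/s, which contributes
    ln (1 / (40 rho)) = A ^ 3 - ln 4; this is at least 2 A, which is what
    [lambda] <= 1/2 requires. *)
Lemma RInt_psi_div_ge (eta : R -> R) (A : R) :
  cutoff eta -> 2 <= A -> 2 * A <= RInt (fun s => psi eta A s / s) 0 (1 / 10).
Proof.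
  intros Heta HA. pose proof (rho_pos A) as Hrho.
  assert (Hln4 : ln 4 <= 3).
  { rewrite <- (ln_exp 3). apply ln_le; [lra |].
    pose proof (exp_ineq1_le 3). lra. }
  assert (HA3 : 4 * A <= A ^ 3) by nra.
  assert (Elow : ln (2 * rho A) = ln (1 / 20) - (A ^ 3 - ln 4)).
  { replace (2 * rho A) with (1 / 20 * (4 * exp (- A ^ 3))) by (unfold rho; field).
    pose proof (exp_pos (- A ^ 3)).
    rewrite !ln_mult, ln_exp by lra. ring. }
  assert (Hlow : 2 * rho A <= 1 / 20).
  { apply Rnot_lt_le. intros C. apply ln_increasing in C; lra. }
  assert (Hpos : forall a b, 0 <= a <= b -> 0 <= RInt (fun s => psi eta A s / s) a b).
  { intros a b Hab. apply RInt_ge_0; [lra | now apply ex_RInt_psi_div |].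
    intros s Hs. apply Rmult_le_pos; [now apply psi_bounds |].
    left; apply Rinv_0_lt_compat; lra. }
  assert (Emid : RInt (fun s => psi eta A s / s) (2 * rho A) (1 / 20)
                 = A ^ 3 - ln 4).
  { apply is_RInt_unique.
    replace (A ^ 3 - ln 4) with (ln (1 / 20) - ln (2 * rho A)) by lra.
    apply is_RInt_ext with (fun s => 1 / s); [| apply is_RInt_inv; lra].
    rewrite Rmin_left, Rmax_right by lra. intros s Hs.
    rewrite psi_middle; auto; lra. }
  assert (C1 := RInt_Chasles (fun s => psi eta A s / s) 0 (2 * rho A) (1 / 20)
    (ex_RInt_psi_div _ _ _ _ Heta) (ex_RInt_psi_div _ _ _ _ Heta)).
  assert (C2 := RInt_Chasles (fun s => psi eta A s / s) 0 (1 / 20) (1 / 10)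
    (ex_RInt_psi_div _ _ _ _ Heta) (ex_RInt_psi_div _ _ _ _ Heta)).
  unfold plus in C1, C2; simpl in C1, C2.
  pose proof (Hpos 0 (2 * rho A) ltac:(lra)).
  pose proof (Hpos (1 / 20) (1 / 10) ltac:(lra)). lra.
Qed.

Lemma lambda_bounds (eta : R -> R) (A : R) :
  cutoff eta -> 2 <= A -> 0 <= lambda eta A <= 1 / 2.
Proof.
  intros Heta HA. pose proof (RInt_psi_div_ge eta A Heta HA). unfold lambda.
  split; [apply Rdiv_le_0_compat; lra | apply Rle_div_l; lra].
Qed.

Lemma phi_0 (eta : R -> R) (A : R) : phi eta A 0 = exp (- A).
Proof.
  unfold phi, logphi. rewrite (RInt_point (V := R_CompleteNormedModule)).
  unfold zero; simpl. f_equal; ring.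
Qed.

(** As [logphi] vanishes at 1/10, it is minus [lambda] times the integral of
    psi(s)/s from r to 1/10.  Since psi <= 1 and [lambda] <= 1/2, it is at least
    ln (10 r) / 2, which is ln |t| at r = t ^ 2 / 10. *)
Lemma phi_ge (eta : R -> R) (A t : R) :
  cutoff eta -> 2 <= A -> Rabs t <= 1 -> Rabs t <= phi eta A (t ^ 2 / 10).
Proof.
  intros Heta HA Ht1. rewrite <- pow2_abs.
  destruct (Rabs_pos t) as [Ht0 | <-]; [| left; apply exp_pos].
  assert (Ht : 0 < Rabs t <= 1) by lra. clear Ht0 Ht1.
  revert Ht. generalize (Rabs t). clear t. intros t Ht.
  unfold phi. rewrite <- (exp_ln t) at 1 by lra.
  assert (Hm : ln t <= logphi eta A (t ^ 2 / 10));
    [| destruct Hm as [Hm | ->]; [left; now apply exp_increasing | lra]].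
  pose proof (lambda_bounds eta A Heta HA) as Hlam.
  pose proof (RInt_psi_div_ge eta A Heta HA) as HI.
  assert (Hr : 0 < t ^ 2 / 10 <= 1 / 10) by nra.
  set (r := t ^ 2 / 10) in *.
  assert (C := RInt_Chasles (fun s => psi eta A s / s) 0 r (1 / 10)
    (ex_RInt_psi_div _ _ _ _ Heta) (ex_RInt_psi_div _ _ _ _ Heta)).
  unfold plus in C; simpl in C.
  assert (E : lambda eta A * RInt (fun s => psi eta A s / s) 0 (1 / 10) = A).
  { unfold lambda. field. lra. }
  assert (Htail : RInt (fun s => psi eta A s / s) r (1 / 10) <= ln (1 / 10) - ln r).
  { rewrite <- (is_RInt_unique _ _ _ _ (is_RInt_inv r (1 / 10) Hr)).
    apply RInt_le; [lra | now apply ex_RInt_psi_div | |].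
    - eexists; now apply is_RInt_inv.
    - intros s Hs. apply Rmult_le_compat_r; [| now apply psi_bounds].
      left; apply Rinv_0_lt_compat; lra. }
  assert (Er : ln (1 / 10) - ln r = - (2 * ln t)).
  { unfold r. replace (t ^ 2 / 10) with (t * t * (1 / 10)) by field.
    rewrite !ln_mult by nra. ring. }
  assert (Hlnt : ln t <= 0) by (rewrite <- ln_1; apply ln_le; lra).
  unfold logphi. rewrite <- C, Rmult_plus_distr_l in E.
  nra.
Qed.

(** * Comparing the two distances *)

Lemma profile_at_2 (eta : R -> R) (A : R) (u p : R -> R) :
  profile eta A u p -> u 2 = 0.
Proof.
  intros H. rewrite (u_outer _ _ _ _ H) by lra. rewrite (p_total _ _ _ _ H). ring.
Qed.

(** Parametrised by r = t ^ 2 / 10, the radial coordinate speed |t| / 5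
    compensates the lower bound |t| for [phi]: the speed is at most 1/5 however
    small [phi] becomes at the pole.  Moreover t runs through [-1, 0] on the way
    to the pole and through [0, 1] on the way back. *)
Lemma joins_radial (eta : R -> R) (A : R) (u : R -> R) (theta xi a b L' : R)
  (q : point) :
  cutoff eta -> 2 <= A -> u 0 = 0 -> u 2 = 0 -> -1 <= a -> a < b -> b <= 1 ->
  joins S2xS1 (metric_g eta A u) (polar (b ^ 2 / 10) theta xi) q L' ->
  exists L, L <= (b - a) / 5 /\
    joins S2xS1 (metric_g eta A u) (polar (a ^ 2 / 10) theta xi) q (L + L').
Proof.
  intros Heta HA U0 U2 Ha Hab Hb Hq.
  set (speed := fun t => Rabs (t / 5) / phi eta A (t ^ 2 / 10)).
  assert (Hex : ex_RInt speed a b).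
  { apply (ex_RInt_continuous (V := R_CompleteNormedModule)).
    intros t _. unfold speed, Rdiv at 1.
    apply (continuous_mult (K := R_AbsRing) (fun t => Rabs (t / 5))).
    - apply continuous_Rabs_comp, (ex_derive_continuous (fun t => t / 5)).
      auto_derive; auto.
    - apply continuous_Rinv_comp; [| apply Rgt_not_eq, exp_pos].
      apply (continuous_comp (fun t => t ^ 2 / 10) (phi eta A));
        [| now apply continuous_phi].
      apply (ex_derive_continuous (fun t => t ^ 2 / 10)). auto_derive; auto. }
  destruct Hex as [L HL]. exists L. split.
  - rewrite <- (is_RInt_unique _ _ _ _ HL).
    eapply Rle_trans; [apply Rle_abs |].
    replace ((b - a) / 5) with ((b - a) * (1 / 5)) by field.
    apply abs_RInt_le_const; [lra | now exists L |].
    intros t Ht. unfold speed.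
    pose proof (exp_pos (logphi eta A (t ^ 2 / 10))) as Hphi.
    fold (phi eta A (t ^ 2 / 10)) in Hphi.
    pose proof (phi_ge eta A t Heta HA ltac:(apply Rabs_le; lra)).
    rewrite Rabs_pos_eq by (apply Rdiv_le_0_compat; [apply Rabs_pos | auto]).
    apply Rle_div_l; auto.
    unfold Rdiv at 1. rewrite Rabs_mult, (Rabs_pos_eq (/ 5)) by lra. lra.
  - apply (joins_polar _ _ _ (fun t => t ^ 2 / 10) (fun _ => theta) (fun _ => xi)
      (fun t => t / 5) (fun _ => 0) (fun _ => 0) a b); auto;
      try (intros t; apply continuous_const);
      try (intros t; apply @is_derive_const).
    + intros t. auto_derive; auto. field.
    + intros t. apply (ex_derive_continuous (fun t => t / 5)). auto_derive; auto.
    + intros t Ht. nra.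
    + intros; apply S2xS1_polar.
    + apply is_RInt_ext with (2 := HL). intros t _. unfold speed.
      pose proof (exp_pos (logphi eta A (t ^ 2 / 10))) as Hphi.
      fold (phi eta A (t ^ 2 / 10)) in Hphi.
      rewrite <- (sqrt_pow2 (Rabs (t / 5) / _))
        by (apply Rdiv_le_0_compat; [apply Rabs_pos | auto]).
      f_equal. unfold Rdiv at 1. rewrite Rpow_mult_distr, pow2_abs. field. lra.
Qed.

Lemma joins_fibre (X : point -> Prop) (phi u : R -> R) (r theta a b L' : R)
  (q : point) :
  u 0 = 0 -> u 2 = 0 -> 0 <= r <= 2 -> 0 < phi r -> a < b ->
  (forall xi, X (polar r theta xi)) ->
  joins X (warped phi u) (polar r theta b) q L' ->
  joins X (warped phi u) (polar r theta a) q ((b - a) * phi r + L').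
Proof.
  intros U0 U2 Hr Hphi Hab HX Hq.
  apply (joins_polar _ _ _ (fun _ => r) (fun _ => theta) (fun t => t)
      (fun _ => 0) (fun _ => 0) (fun _ => 1) a b); auto;
    try (intros t; apply continuous_const);
    try (intros t; apply @is_derive_const).
  - intros t. apply @is_derive_id.
  - apply is_RInt_ext with (fun _ => phi r).
    + intros t _. rewrite <- (sqrt_pow2 (phi r)) at 1 by lra.
      f_equal. field. lra.
    + apply (is_RInt_const (V := R_NormedModule) a b (phi r)).
Qed.

(** Down to the pole, half way around the fibre there, and up again.  The curve
    is assembled from its end backwards, as [joins] prepends pieces. *)
Lemma shortcut (eta : R -> R) (A : R) (u p : R -> R) :
  cutoff eta -> 2 <= A -> profile eta A u p ->
  exists L, L <= 2 / 5 + PI * exp (- A) /\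
    joins S2xS1 (metric_g eta A u) (polar (1 / 10) 0 0) (polar (1 / 10) 0 PI) L.
Proof.
  intros Heta HA Hu.
  pose proof (u_0 _ _ _ _ Hu) as U0. pose proof (profile_at_2 _ _ _ _ Hu) as U2.
  pose proof PI_RGT_0.
  replace (polar (1 / 10) 0 0) with (polar ((-1) ^ 2 / 10) 0 0) by (f_equal; field).
  replace (polar (1 / 10) 0 PI) with (polar (1 ^ 2 / 10) 0 PI) by (f_equal; field).
  destruct (joins_radial eta A u 0 PI 0 1 0 (polar (1 ^ 2 / 10) 0 PI))
    as (L3 & HL3 & H3); auto; try lra.
  { apply joins_nil, S2xS1_polar. }
  replace (0 ^ 2 / 10) with 0 in H3 by field.
  apply (joins_fibre _ _ _ 0 0 0 PI) in H3; auto; try lra;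
    [| apply exp_pos | intros; apply S2xS1_polar].
  rewrite phi_0 in H3.
  replace (polar 0 0 0) with (polar (0 ^ 2 / 10) 0 0) in H3 by (f_equal; field).
  destruct (joins_radial eta A u 0 0 (-1) 0 _ _ Heta HA U0 U2
    ltac:(lra) ltac:(lra) ltac:(lra) H3) as (L1 & HL1 & H1).
  eexists; split; [| exact H1]. lra.
Qed.

Lemma compact_pair {T : UniformSpace} (a b : T) :
  compact_set (fun x => x = a \/ x = b).
Proof.
  intros I U _ Hcov.
  destruct (Hcov a (or_introl eq_refl)) as [i Hi].
  destruct (Hcov b (or_intror eq_refl)) as [j Hj].
  exists (i :: j :: nil)%list. intros x [-> | ->]; [exists i | exists j];
    simpl; auto.
Qed.

Lemma unif_cv_eq0 (D : R -> Prop) (F : nat -> R -> R) (f : R -> R) (x : R) (N : nat) :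
  unif_cv D F f -> D x -> (forall n, (N <= n)%nat -> F n x = 0) -> f x = 0.
Proof.
  intros Hcv Hx H0. destruct (Req_dec (f x) 0) as [| E]; auto.
  destruct (Hcv (Rabs (f x)) (Rabs_pos_lt _ E)) as [M HM].
  specialize (HM (max M N) ltac:(lia) x Hx).
  rewrite H0, Rminus_0_l, Rabs_Ropp in HM by lia. lra.
Qed.

Lemma strictly_increasing_ge (sigma : nat -> nat) :
  (forall n, (sigma n < sigma (S n))%nat) -> forall n, (n <= sigma n)%nat.
Proof. intros H n. induction n; [lia | specialize (H n); lia]. Qed.

Theorem lemmaA8
  (A : nat -> R) (eta : R -> R) (u p : nat -> R -> R)
  (A_pos : forall i, 0 < A i)
  (A_lim : is_lim_seq A p_infty)
  (eta_cutoff : cutoff eta)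
  (u_profile : exists N : nat, forall i, (N <= i)%nat ->
     profile eta (A i) (u i) (p i))
  (p_C1_bound : exists (C : R) (N : nat), forall i, (N <= i)%nat ->
     forall r, 1 / 5 <= r <= 2 ->
       Rabs (p i r) <= C /\ Rabs (Derive (p i) r) <= C)
  (sigma : nat -> nat)
  (sigma_incr : forall n, (sigma n < sigma (S n))%nat)
  (u_inf : R -> R)
  (u_cv : unif_cv (fun r => 0 <= r <= 2) (fun n => u (sigma n)) u_inf)
  (phi_cv : forall a b, 0 < a -> a < b -> b < 2 ->
     unif_cv (fun r => a <= r <= b)
       (fun n => phi eta (A (sigma n))) (fun _ => 1))
  (d_star : point -> point -> R)
  (d_star_metric : is_metric_on Mint d_star)
  (d_cv : forall K : point -> Prop,
     compact_set K -> (forall x, K x -> Mint x) ->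
     unif_cv (fun xy : point * point => K (fst xy) /\ K (snd xy))
       (fun n xy => length_dist S2xS1
          (metric_g eta (A (sigma n)) (u (sigma n))) (fst xy) (snd xy))
       (fun xy => d_star (fst xy) (snd xy))) :
  exists x y : point, Mint x /\ Mint y /\
    d_star x y < length_dist Mint (metric_lim u_inf) x y.

Proof.
  pose proof PI_RGT_0. pose proof PI_4.
  set (x := polar (1 / 10) 0 0). set (y := polar (1 / 10) 0 PI).
  assert (Hx : Mint x) by (apply Mint_polar; lra).
  assert (Hy : Mint y) by (apply Mint_polar; lra).
  exists x, y. split; [exact Hx | split; [exact Hy |]].
  destruct u_profile as [N1 HN1].
  pose proof (strictly_increasing_ge sigma sigma_incr) as Hsig.
  assert (U0 : u_inf 0 = 0).
  { apply (unif_cv_eq0 _ _ _ 0 N1 u_cv); [lra |]. intros n Hn. specialize (Hsig n).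
    apply (u_0 eta (A (sigma n)) _ (p (sigma n))), HN1; lia. }
  assert (U2 : u_inf 2 = 0).
  { apply (unif_cv_eq0 _ _ _ 2 N1 u_cv); [lra |]. intros n Hn. specialize (Hsig n).
    apply (profile_at_2 eta (A (sigma n)) _ (p (sigma n))), HN1; lia. }
  assert (Hlim : 2 <= length_dist Mint (metric_lim u_inf) x y).
  { (* Half of the fibre through x and y is the curve that makes the infimum
       finite; its length is PI. *)
    apply (length_dist_bounds _ _ _ _ _ ((PI - 0) * 1 + 0)).
    - intros l Hl. apply fibre_displacement_le in Hl; [| now intros z []].
      unfold x, y, polar in Hl; cbn [fst snd] in Hl.
      rewrite cos_0, cos_PI in Hl. pose proof (Rle_abs (1 - -1)). lra.
    - apply (joins_fibre Mint (fun _ => 1) u_inf (1 / 10) 0 0 PI); auto; try lra.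
      + intros xi. apply Mint_polar; lra.
      + now apply joins_nil. }
  (* An error 1/10 in the limit and A >= 10 leave
     d_*(x, y) <= 1/10 + 2/5 + PI / 10 < 2. *)
  destruct (d_cv _ (compact_pair x y) ltac:(now intros z [-> | ->]) (1 / 10)
    ltac:(lra)) as [N2 HN2].
  destruct (proj2 (is_lim_seq_spec A p_infty) A_lim 10) as [N3 HN3].
  set (n := max N1 (max N2 N3)). pose proof (Hsig n) as Hn.
  specialize (HN1 (sigma n) ltac:(lia)). specialize (HN3 (sigma n) ltac:(lia)).
  specialize (HN2 n ltac:(lia) (x, y) ltac:(simpl; auto)). simpl in HN2.
  destruct (shortcut eta (A (sigma n)) _ _ eta_cutoff ltac:(lra) HN1)
    as (L & HL & Hjoin).
  pose proof (length_dist_bounds _ _ _ _ 0 L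
    (fun l Hl => joins_ge0 _ _ _ _ l Hl) Hjoin) as Hdn.
  assert (Hexp : exp (- A (sigma n)) <= 1 / 10).
  { rewrite exp_Ropp. replace (1 / 10) with (/ 10) by field.
    apply Rinv_le_contravar; [lra |].
    pose proof (exp_ineq1_le (A (sigma n))). lra. }
  assert (PI * exp (- A (sigma n)) <= 4 / 10).
  { pose proof (exp_pos (- A (sigma n))). nra. }
  apply Rcomplements.Rabs_lt_between in HN2. fold x y in Hdn. lra.
Qed.
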